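(* Let $G$ be an electrical network whose resistance form $(\mathcal E_G,\mathcal F_G)$ is recurrent, and let $B\subseteq V_G$ be non-empty. Set $V(G|_B)=B$; for $x,y\in B$ let $$c_{G|_B}(x,y)=\begin{cases}-\mathcal E_G|_B(1_{\{x\}},1_{\{y\}}),&x\ne y,\\0,&x=y\end{cases}$$ (which is non-negative), and let $E(G|_B)$ be the set of pairs $\{x,y\}$ with $c_{G|_B}(x,y)>0$. Then $(V(G|_B),E(G|_B),c_{G|_B})$ is an electrical network. Moreover, its associated resistance form $(\mathcal E_{G|_B},\mathcal F_{G|_B})$ coincides with the trace $(\mathcal E_G|_B,\mathcal F_G|_B)$. In particular, its associated resistance metric is $R_G|_{B\times B}$.
   Context: **Electrical networks.** An electrical network $G=(V_G,E_G,c_G)$ is a connected simple undirected graph with finite or countable vertex set $V_G$ and edge set $E_G$, with symmetric conductances $c_G(x,y)\ge0$, positive iff $\{x,y\}\in E_G$, and $c_G(x)=\sum_yc_G(x,y)<\infty$ for all $x$. Its associated resistance form is $\mathcal E_G(f,g)=\frac12\sum_{x,y}c_G(x,y)(f(x)-f(y))(g(x)-g(y))$ on $\mathcal F_G=\{f:V_G\to\mathbb R:\mathcal E_G(f,f)<\infty\}$ (with $E_G$ the edge set and $\mathcal{E}_G$ the form). Its resistance metric is $R_G(x,y)=\sup\{|f(x)-f(y)|^2/\mathcal E_G(f,f):f\in\mathcal F_G,\mathcal E_G(f,f)>0\}$, which is a metric inducing the discrete topology on $V_G$. **Recurrence.** For $A,A'\subseteq V_G$, $R_G(A,A')=\bigl(\inf\{\mathcal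 E_G(f,f):f\in\mathcal F_G,f|_A=1,f|_{A'}=0\}\bigr)^{-1}$ ($0$ if no such $f$, $\infty$ if the infimum is $0$). $(\mathcal E_G,\mathcal F_G)$ is recurrent if there is an increasing sequence of finite sets $U_n$ with $\bigcup_nU_n=V_G$ and $R_G(\{\rho\},U_n^c)\to\infty$ for some $\rho\in V_G$. **Trace of the resistance form.** $\mathcal F_G|_B=\{u|_B:u\in\mathcal F_G\}$ and $\mathcal E_G|_B(\varphi,\psi)=\mathcal E_G(h_B(\varphi),h_B(\psi))$, where $h_B(\varphi)$ is the unique function in $\mathcal F_G$ with restriction $\varphi$ to $B$ that minimizes $\mathcal E_G(u,u)$ among $u\in\mathcal F_G$ with $u|_B=\varphi$. It is a resistance form on $B$. *)

(* Defs.v *)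
From mathcomp Require Import all_boot all_order all_algebra.
From mathcomp Require Import all_classical all_reals all_analysis.

Set Implicit Arguments.
Unset Strict Implicit.
Unset Printing Implicit Defensive.

Import Order.TTheory GRing.Theory Num.Theory.
Import numFieldNormedType.Exports.
Local Open Scope classical_set_scope.
Local Open Scope ring_scope.

Record electrical_network (R : realType) (V : choiceType)
    (e : rel V) (c : V -> V -> R) : Prop := ElectricalNetwork {
  network_nonempty : [set: V] !=set0;
  network_countable : countable [set: V];
  network_edge_irr : irreflexive e;
  network_edge_sym : symmetric e;
  network_connected : forall x y, exists2 p : seq V, path e x p & last x p = y;
  network_cond_ge0 : forall x y, 0 <= c x y;
  network_cond_sym : forall x y, c x y = c y x;
  network_cond_edge : forall x y, (0 < c x y) = e x y;
  network_cond_fin : forall x, (\esum_(y in [set: V]) (c x y)%:E < +oo)%E }.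

(* [\esum] is only meaningful for non-negative terms; the positive and negative
   parts are both finite exactly when the family is absolutely summable. *)
Definition signed_esum (R : realType) (T : choiceType) (a : T -> \bar R) :
    \bar R :=
  (\esum_(i in [set: T]) (a^\+ i) - \esum_(i in [set: T]) (a^\- i))%E.

(* The sum runs over ordered pairs, hence the factor 1/2. For [f = g] and
   [0 <= c] all terms are non-negative and the value lies in [0, +oo]; for [f]
   and [g] in [finite_energy c] the family is absolutely summable. *)
Definition energy (R : realType) (V : choiceType) (c : V -> V -> R)
    (f g : V -> R) : \bar R :=
  (2^-1%:E * signed_esum (fun p : V * V =>
     (c p.1 p.2 * (f p.1 - f p.2) * (g p.1 - g p.2))%:E))%E.

Definition finite_energy (R : realType) (V : choiceType) (c : V -> V -> R) :
    set (V -> R) :=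
  [set f | (energy c f f < +oo)%E].

(* On a network the set below is bounded. When [V] is a single point it is
   empty, and [sup set0 = 0] is the intended value. *)
Definition resistance_metric (R : realType) (V : choiceType) (c : V -> V -> R)
    (x y : V) : R :=
  sup [set `|f x - f y| ^+ 2 / fine (energy c f f) | f in
        [set f | finite_energy c f /\ (0 < energy c f f)%E]].

Definition separating (R : realType) (V : choiceType) (c : V -> V -> R)
    (A A' : set V) : set (V -> R) :=
  [set f | [/\ finite_energy c f, (forall x, A x -> f x = 1) &
               (forall x, A' x -> f x = 0)]].

(* In [\bar R], [ereal_inf set0 = +oo], [+oo^-1 = 0] and [0^-1 = +oo]. *)
Definition effective_resistance (R : realType) (V : choiceType)
    (c : V -> V -> R) (A A' : set V) : \bar R :=
  ((ereal_inf [set energy c f f | f in separating c A A'])^-1)%E.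

Definition recurrent (R : realType) (V : choiceType) (c : V -> V -> R) : Prop :=
  exists U : nat -> set V,
    [/\ forall n, finite_set (U n),
        forall n, U n `<=` U n.+1,
        \bigcup_n U n = [set: V] &
        exists rho : V,
          (fun n => effective_resistance c [set rho] (~` U n)) @ \oo --> +oo%E].

Section Trace.
Variables (R : realType) (V : choiceType) (c : V -> V -> R) (B : set V).

Definition restriction (u : V -> R) : B -> R := fun x => u (val x).

Definition trace_domain : set (B -> R) :=
  [set restriction u | u in finite_energy c].

Definition energy_minimizer (phi : B -> R) : set (V -> R) :=
  [set u | [/\ finite_energy c u, restriction u = phi &
    forall v, finite_energy c v -> restriction v = phi ->
      (energy c u u <= energy c v v)%E]].

(* The minimizer is unique when the network is connected and [B] is non-empty;
   the default value is only reached for [phi] outside [trace_domain]. *)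
Definition harmonic_extension (phi : B -> R) : V -> R :=
  xget (fun=> 0) (energy_minimizer phi).

Definition trace_form (phi psi : B -> R) : \bar R :=
  energy c (harmonic_extension phi) (harmonic_extension psi).

Definition trace_cond (x y : B) : R :=
  if x == y then 0 else - fine (trace_form \1_[set x] \1_[set y]).

Definition trace_edge : rel B := fun x y => 0 < trace_cond x y.

End Trace.

Arguments restriction {R V} B u x.
Arguments trace_domain {R V} c B.
Arguments trace_form {R V} c B phi psi.
Arguments trace_cond {R V} c B x y.
Arguments trace_edge {R V} c B x y.

(* Main.v *)
Require Import Defs.
From mathcomp Require Import all_boot all_order all_algebra.
From mathcomp Require Import all_classical all_reals all_analysis.
From mathcomp Require Import lra ring.

Set Implicit Arguments.
Unset Strict Implicit.
Unset Printing Implicit Defensive.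

Import Order.TTheory GRing.Theory Num.Theory.
Import numFieldNormedType.Exports.
Local Open Scope classical_set_scope.
Local Open Scope ring_scope.

(** Write E for the energy of G, C for the trace conductances and E_C for their
    energy. The potential of x in B is the minimiser g_x with boundary values
    1_{x}; it is E-orthogonal to all functions vanishing on B, so
    C(x,y) = - E(g_x, g_y), which is non-negative because replacing g_x - g_y by
    its absolute value does not increase the energy. Recurrence gives finitely
    supported functions with values in [0,1], close to 1 on any finite set, and
    of small energy; testing g_x against them shows
    sum_y C(x,y) = E(g_x, g_x), i.e. the trace has no killing. Hence E_C(phi) is
    the minimal energy of an extension of phi when phi is finitely supported,
    and the restricted cutoffs are cutoffs for C too. Multiplying a truncation by
    a cutoff approximates any function of finite energy pointwise by finitely
    supported ones without increasing the energy by much. Carrying this out on V,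
    lower semicontinuity of E_C gives E_C(u|_B) <= E(u); carrying it out on B,
    compactness of energy-bounded sets for pointwise convergence gives an
    extension u of phi with E(u) <= E_C(phi). Polarisation, connectedness (the
    indicator of a component has zero energy) and the resistance formula follow. *)

(** * Signed sums *)

Section SignedSums.
Variables (R : realType) (T : choiceType).
Implicit Types (a b p q : T -> R) (s : seq T).

(** An [esum] is a supremum over finite sets, and duplicate-free sequences list these; energy bounds
    thereby reduce to finite sums. *)
Lemma esum_leP a (M : R) : (forall i, 0 <= a i) ->
  (\esum_(i in [set: T]) (a i)%:E <= M%:E)%E <->
  (forall s, uniq s -> \sum_(i <- s) a i <= M).
Proof.
move=> a0; split=> [leM s us|leM].
  rewrite -lee_fin; apply: le_trans leM; apply: esum_ge.
  by exists [set` s]; [split|rewrite -fsbig_seq// sumEFin].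
apply: ge_ereal_sup => _ [X [/finite_seqP[s ->] _] <-].
have -> : [set` s] = [set` undup s] by apply/seteqP; split=> i /=; rewrite mem_undup.
by rewrite -fsbig_seq ?undup_uniq// sumEFin lee_fin leM ?undup_uniq.
Qed.

Lemma signed_esum_ge0 a : (forall i, 0 <= a i) ->
  signed_esum (fun i => (a i)%:E) = \esum_(i in [set: T]) (a i)%:E.
Proof.
move=> a0; rewrite /signed_esum [X in (_ - X)%E]esum1 ?sube0.
  by apply: eq_esum => i _; rewrite funepos.unlock; apply/max_idPl; rewrite lee_fin.
by move=> i _; rewrite funeneg.unlock; apply/max_idPr; rewrite leeNl oppe0 lee_fin.
Qed.

Lemma esum_fin_numE p : (forall i, 0 <= p i) ->
  summable [set: T] (EFin \o p) -> \esum_(i in [set: T]) (p i)%:E \is a fin_num.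
Proof.
move=> p0; rewrite summableE; congr (_ \is a fin_num).
by apply: eq_esum => i _ /=; rewrite ger0_norm.
Qed.

(** Any splitting into non-negative summable parts gives the same value, not only the canonical one.
    Additivity rests on this, because the positive part of a sum is not the sum of the positive
    parts. *)
Lemma signed_esumB p q : (forall i, 0 <= p i) -> (forall i, 0 <= q i) ->
  summable [set: T] (EFin \o p) -> summable [set: T] (EFin \o q) ->
  signed_esum (fun i => (p i - q i)%:E) =
  (\esum_(i in [set: T]) (p i)%:E - \esum_(i in [set: T]) (q i)%:E)%E.
Proof.
by move=> p0 q0 sp sq; rewrite -(esumB sp sq)// => i _; rewrite lee_fin.
Qed.

Lemma summable_le a b : (forall i, `|a i| <= `|b i|) ->
  summable [set: T] (EFin \o b) -> summable [set: T] (EFin \o a).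
Proof.
move=> ab; apply: le_lt_trans; apply: le_esum => i _.
by rewrite /= lee_fin ab.
Qed.

Lemma summable_pos a : summable [set: T] (EFin \o a) ->
  summable [set: T] (EFin \o (fun i => Num.max (a i) 0)).
Proof.
by apply: summable_le => i; case: (ltrP 0 (a i)) => //; rewrite normr0.
Qed.

Lemma summable_neg a : summable [set: T] (EFin \o a) ->
  summable [set: T] (EFin \o (fun i => Num.max (- a i) 0)).
Proof.
by apply: summable_le => i; case: (ltrP 0 (- a i)); rewrite ?normr0// normrN.
Qed.

Lemma max_sub_max a i : a i = Num.max (a i) 0 - Num.max (- a i) 0.
Proof.
by case: (ltrP 0 (a i)) => h; case: (ltrP 0 (- a i)) => h'; lra.
Qed.

Definition rsum a : R := fine (signed_esum (fun i => (a i)%:E)).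

Lemma signed_esum_posneg a : summable [set: T] (EFin \o a) ->
  signed_esum (fun i => (a i)%:E) =
  (\esum_(i in [set: T]) (Num.max (a i) 0)%:E
   - \esum_(i in [set: T]) (Num.max (- a i) 0)%:E)%E.
Proof.
move=> sa; rewrite -signed_esumB; [|by move=> i; rewrite le_max lexx orbT..
  |exact: summable_pos|exact: summable_neg].
by congr signed_esum; apply/funext => i; rewrite -max_sub_max.
Qed.

Lemma signed_esum_rsum a : summable [set: T] (EFin \o a) ->
  signed_esum (fun i => (a i)%:E) = (rsum a)%:E.
Proof.
move=> sa; rewrite /rsum fineK// signed_esum_posneg// fin_numB.
have ge0 (x : R) : 0 <= Num.max x 0 by rewrite le_max lexx orbT.
rewrite (esum_fin_numE _ (summable_pos sa))// (esum_fin_numE _ (summable_neg sa))//.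
Qed.

Lemma rsumD a b : summable [set: T] (EFin \o a) -> summable [set: T] (EFin \o b) ->
  rsum (fun i => a i + b i) = rsum a + rsum b.
Proof.
move=> sa sb; apply: EFin_inj; rewrite EFinD -!signed_esum_rsum//; last first.
  exact: summableD sa sb.
rewrite (signed_esum_posneg sa) (signed_esum_posneg sb).
have ge0 (x : R) : 0 <= Num.max x 0 by rewrite le_max lexx orbT.
have -> : (fun i => (a i + b i)%:E) = (fun i =>
    ((Num.max (a i) 0 + Num.max (b i) 0) -
     (Num.max (- a i) 0 + Num.max (- b i) 0))%:E).
  apply/funext => i; congr EFin.
  by rewrite {1}(max_sub_max a) {1}(max_sub_max b); ring.
have sap := summable_pos sa; have sbp := summable_pos sb.
have san := summable_neg sa; have sbn := summable_neg sb.
rewrite signed_esumB; [|by move=> i; rewrite addr_ge0..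
  |exact: summableD sap sbp|exact: summableD san sbn].
under eq_esum do rewrite EFinD.
under [X in (_ - X)%E]eq_esum do rewrite EFinD.
rewrite !esumD; [|by move=> i _; rewrite lee_fin..].
have := esum_fin_numE (fun i => ge0 (a i)) sap.
have := esum_fin_numE (fun i => ge0 (b i)) sbp.
have := esum_fin_numE (fun i => ge0 (- a i)) san.
have := esum_fin_numE (fun i => ge0 (- b i)) sbn.
do 4 (move=> /fineK <-); rewrite -!EFinD; congr EFin; ring.
Qed.

Lemma rsum_ge0E a : (forall i, 0 <= a i) -> summable [set: T] (EFin \o a) ->
  \esum_(i in [set: T]) (a i)%:E = (rsum a)%:E.
Proof. by move=> a0 sa; rewrite -signed_esum_rsum// signed_esum_ge0. Qed.

Lemma rsumN a : summable [set: T] (EFin \o a) ->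
  rsum (fun i => - a i) = - rsum a.
Proof.
move=> sa; have sNa : summable [set: T] (EFin \o (fun i => - a i)).
  by apply: summable_le sa => i; rewrite normrN.
apply/eqP; rewrite -addr_eq0 -rsumD//; apply/eqP.
rewrite /rsum signed_esum_ge0; last by move=> i; rewrite addNr.
by rewrite esum1// => i _; rewrite addNr.
Qed.

Lemma summableZ k a : summable [set: T] (EFin \o a) ->
  summable [set: T] (EFin \o (fun i => k * a i)).
Proof.
(* Summability is known to be stable under addition, so [k] is dominated by an integer multiple,
   built by induction. *)
move=> sa; have [n kn] : exists n, `|k| <= n%:R.
  by exists (Num.truncn `|k|).+1; rewrite ltW// truncnS_gt.
have sna : summable [set: T] (EFin \o (fun i => n%:R * a i)).
  elim: {kn}n => [|n IH].
    by apply: summable_le sa => i; rewrite mul0r normr0.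
  apply: (summable_le _ (summableD IH sa)) => i /=.
  by rewrite -natr1 mulrDl mul1r.
apply: summable_le sna => i; rewrite !normrM ler_wpM2r//.
by rewrite (le_trans kn)// normr_nat.
Qed.

(** One inequality suffices: applied to [k^-1] and the scaled family, it yields the reverse one. *)
Lemma rsumZ_ge0 k a : 0 < k -> (forall i, 0 <= a i) ->
  summable [set: T] (EFin \o a) -> rsum (fun i => k * a i) = k * rsum a.
Proof.
have le (l : R) p : 0 <= l -> (forall i, 0 <= p i) ->
    summable [set: T] (EFin \o p) -> rsum (fun i => l * p i) <= l * rsum p.
  move=> l0 p0 sp; rewrite -lee_fin -rsum_ge0E; last exact: summableZ.
    apply/esum_leP => [i|s us]; first by rewrite mulr_ge0.
    rewrite -mulr_sumr ler_wpM2l//.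
    by apply: (esum_leP _ p0).1 s us; rewrite rsum_ge0E.
  by move=> i; rewrite mulr_ge0.
move=> k0 a0 sa; apply/le_anti/andP; split; first exact/le/sa/a0/ltW.
have ka0 i : 0 <= k * a i by rewrite mulr_ge0// ltW.
have := le k^-1 (fun i => k * a i) _ ka0 (summableZ k sa).
rewrite invr_ge0 ltW// => /(_ isT).
under [X in rsum X]eq_fun do rewrite mulKf ?gt_eqF//.
by rewrite ler_pdivlMl.
Qed.

Lemma rsumZ k a : summable [set: T] (EFin \o a) ->
  rsum (fun i => k * a i) = k * rsum a.
Proof.
move=> sa.
have ge0 (x : R) : 0 <= Num.max x 0 by rewrite le_max lexx orbT.
have sap := summable_pos sa; have san := summable_neg sa.
have pos (l : R) : 0 < l -> rsum (fun i => l * a i) = l * rsum a.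
  move=> l0.
  have eqa : a = fun i => Num.max (a i) 0 + (- Num.max (- a i) 0).
    by apply/funext => i; rewrite -max_sub_max.
  have sNan : summable [set: T] (EFin \o (fun i => - Num.max (- a i) 0)).
    by apply: summable_le san => i; rewrite normrN.
  rewrite [in RHS]eqa rsumD// rsumN//.
  have -> : (fun i => l * a i) =
      (fun i => l * Num.max (a i) 0 + - (l * Num.max (- a i) 0)).
    by apply/funext => i; rewrite -mulrBr -max_sub_max.
  rewrite rsumD; [|exact: summableZ|by rewrite -[X in summable _ X]/(EFin \o _);
     apply: summable_le (summableZ l san) => i; rewrite normrN].
  by rewrite rsumN ?rsumZ_ge0 ?mulrDr ?mulrN//; exact: summableZ.
case: (ltrgtP k 0) => [k0|k0|->]; [|exact: pos|].
  have := pos (- k); rewrite oppr_gt0 => /(_ k0).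
  under [X in rsum X]eq_fun do rewrite mulNr.
  by rewrite rsumN ?mulNr; [move/oppr_inj|exact: summableZ].
rewrite mul0r; under [X in rsum X]eq_fun do rewrite mul0r.
by rewrite /rsum signed_esum_ge0// esum1.
Qed.

End SignedSums.

(** * The energy form *)

Section Energy.
Variables (R : realType) (T : choiceType) (c : T -> T -> R).
Hypothesis c0 : forall x y, 0 <= c x y.
Implicit Types (f g h : T -> R) (s : seq (T * T)) (x y : T).

Definition en f g : R := fine (energy c f g).

Definition energy_term f g (p : T * T) : R :=
  c p.1 p.2 * (f p.1 - f p.2) * (g p.1 - g p.2).

Lemma energy_termE f p : energy_term f f p = c p.1 p.2 * (f p.1 - f p.2) ^+ 2.
Proof. by rewrite /energy_term expr2 mulrA. Qed.

Lemma energy_term_ge0 f p : 0 <= energy_term f f p.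
Proof. by rewrite energy_termE mulr_ge0// sqr_ge0. Qed.

Lemma energy_diagE f :
  energy c f f = (2^-1%:E * \esum_(p in [set: T * T]) (energy_term f f p)%:E)%E.
Proof. by rewrite /energy signed_esum_ge0//; exact: energy_term_ge0. Qed.

Lemma finite_energyP f :
  finite_energy c f <-> summable [set: T * T] (EFin \o energy_term f f).
Proof.
rewrite /finite_energy /= energy_diagE /summable.
have -> : (\esum_(p in [set: T * T]) `|(EFin \o energy_term f f) p|)%E =
    \esum_(p in [set: T * T]) (energy_term f f p)%:E.
  by apply: eq_esum => p _ /=; rewrite ger0_norm// energy_term_ge0.
have : (0 <= \esum_(p in [set: T * T]) (energy_term f f p)%:E)%E.
  by apply: esum_ge0 => p _; rewrite lee_fin energy_term_ge0.
case: (\esum_(p in _) _)%E => [r| |] //= _.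
  by rewrite -EFinM !ltry.
by rewrite gt0_muley ?lte_fin// ltxx.
Qed.

(** Each mixed term is dominated by the sum of the two diagonal ones, since |ab| <= a^2 + b^2. *)
Lemma finite_energy_summable f g : finite_energy c f -> finite_energy c g ->
  summable [set: T * T] (EFin \o energy_term f g).
Proof.
move=> /finite_energyP Ff /finite_energyP Fg.
apply: (summable_le _ (summableD Ff Fg)) => p /=.
rewrite /energy_term -!mulrA -mulrDr !normrM ler_wpM2l//.
rewrite -!expr2 -normrM [leRHS]ger0_norm ?addr_ge0 ?sqr_ge0//.
set a := f _ - _; set b := g _ - _.
have := sqr_ge0 (a + b); have := sqr_ge0 (a - b).
have := sqr_ge0 a; have := sqr_ge0 b.
by rewrite ler_norml; move=> *; apply/andP; split; lra.
Qed.

Lemma energyEn f g : finite_energy c f -> finite_energy c g ->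
  energy c f g = (en f g)%:E.
Proof.
move=> Ff Fg; rewrite /en fineK// /energy signed_esum_rsum//.
exact: finite_energy_summable.
Qed.

Lemma en_rsum f g : finite_energy c f -> finite_energy c g ->
  en f g = 2^-1 * rsum (energy_term f g).
Proof.
by move=> Ff Fg; rewrite /en /energy signed_esum_rsum//; exact: finite_energy_summable.
Qed.

Lemma en_sym f g : en f g = en g f.
Proof.
by rewrite /en /energy; under eq_fun do rewrite mulrAC.
Qed.

Lemma finite_energy_sum_le f s : finite_energy c f -> uniq s ->
  \sum_(p <- s) energy_term f f p <= 2 * en f f.
Proof.
move=> Ff us; apply: (esum_leP _ (energy_term_ge0 f)).1 => //.
rewrite rsum_ge0E; [|exact: energy_term_ge0|exact: finite_energy_summable].
by rewrite en_rsum// mulVKf.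
Qed.

Lemma finite_energy_ub f (M : R) :
  (forall s, uniq s -> \sum_(p <- s) energy_term f f p <= 2 * M) ->
  finite_energy c f /\ en f f <= M.
Proof.
move=> /(esum_leP _ (energy_term_ge0 f)).2 leM.
have le : (energy c f f <= M%:E)%E.
  by rewrite energy_diagE -(@mulKf _ 2 _ M)// EFinM lee_pmul2l// lte_fin.
have Ff : finite_energy c f by apply: le_lt_trans le _; rewrite ltry.
by split=> //; rewrite -lee_fin -energyEn.
Qed.

Lemma en_ge0 f : 0 <= en f f.
Proof.
rewrite /en fine_ge0// energy_diagE mule_ge0// ?lee_fin//.
by apply: esum_ge0 => p _; rewrite lee_fin energy_term_ge0.
Qed.

(** A bound on squared increments can be weighted by conductances and summed. Contractions, linear
    combinations and products with cutoffs are all treated through it. *)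
Lemma finite_energy_dominated f g h (a b : R) : 0 <= a -> 0 <= b ->
  finite_energy c f -> finite_energy c g ->
  (forall x y, (h x - h y) ^+ 2 <= a * (f x - f y) ^+ 2 + b * (g x - g y) ^+ 2) ->
  finite_energy c h /\ en h h <= a * en f f + b * en g g.
Proof.
move=> a0 b0 Ff Fg dom; apply: finite_energy_ub => s us.
apply: (@le_trans _ _ (\sum_(p <- s) (a * energy_term f f p + b * energy_term g g p))).
  apply: ler_sum => p _; rewrite !energy_termE.
  apply: le_trans (ler_wpM2l (c0 _ _) (dom _ _)) _.
  by rewrite mulrDr mulrCA [X in _ + X]mulrCA.
rewrite big_split/= -!mulr_sumr mulrDr ![2 * (_ * _)]mulrCA lerD//.
  by rewrite ler_wpM2l// finite_energy_sum_le.
by rewrite ler_wpM2l// finite_energy_sum_le.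
Qed.

Lemma finite_energy_contraction f g : finite_energy c f ->
  (forall x y, `|g x - g y| <= `|f x - f y|) ->
  finite_energy c g /\ en g g <= en f f.
Proof.
move=> Ff le; have [] := @finite_energy_dominated f f g 1 0 _ _ Ff Ff _ => //.
  by move=> x y; rewrite mul1r mul0r addr0 -[leLHS]real_normK ?num_real//
    -[leRHS]real_normK ?num_real// lerXn2r.
by rewrite mul1r mul0r addr0.
Qed.

Lemma finite_energyZD a f g : finite_energy c f -> finite_energy c g ->
  finite_energy c (fun x => a * f x + g x).
Proof.
move=> Ff Fg.
have [] := @finite_energy_dominated f g (fun x => a * f x + g x)
  (2 * a ^+ 2) 2 _ _ Ff Fg _ => //; first by rewrite mulr_ge0// sqr_ge0.
by move=> x y; have := sqr_ge0 (a * (f x - f y) - (g x - g y)); nra.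
Qed.

Lemma enZD a f g h : finite_energy c f -> finite_energy c g -> finite_energy c h ->
  en (fun x => a * f x + g x) h = a * en f h + en g h.
Proof.
move=> Ff Fg Fh; rewrite !en_rsum//; last exact: finite_energyZD.
have sf := finite_energy_summable Ff Fh.
have sg := finite_energy_summable Fg Fh.
transitivity (2^-1 * rsum (fun p => a * energy_term f h p + energy_term g h p)).
  by congr (_ * rsum _); apply/funext => p; rewrite /energy_term; ring.
by rewrite rsumD ?rsumZ//; [ring|exact: summableZ].
Qed.

Lemma enZDr a f g h : finite_energy c f -> finite_energy c g -> finite_energy c h ->
  en h (fun x => a * f x + g x) = a * en h f + en h g.
Proof. by move=> *; rewrite en_sym enZD// (en_sym f) (en_sym g). Qed.

Lemma en_sqrZD a f g : finite_energy c f -> finite_energy c g ->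
  en (fun x => a * f x + g x) (fun x => a * f x + g x) =
  a ^+ 2 * en f f + 2 * a * en f g + en g g.
Proof.
move=> Ff Fg; have Fh := finite_energyZD a Ff Fg.
by rewrite enZD// !enZDr// (en_sym g f); ring.
Qed.

Lemma finite_energy_cst k : finite_energy c (fun=> k) /\ en (fun=> k) (fun=> k) <= 0.
Proof.
apply: finite_energy_ub => s _; rewrite mulr0 big1// => p _.
by rewrite energy_termE subrr expr0n mulr0.
Qed.

Lemma finite_energy_sum (I : Type) (r : seq I) (a : I -> R) (F : I -> T -> R) :
  (forall i, finite_energy c (F i)) ->
  finite_energy c (fun x => \sum_(i <- r) a i * F i x).
Proof.
move=> FF; elim: r => [|i r IH].
  by under eq_fun do rewrite big_nil; exact: (finite_energy_cst 0).1.
by under eq_fun do rewrite big_cons; exact: finite_energyZD.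
Qed.

Lemma en_suml (I : Type) (r : seq I) (a : I -> R) (F : I -> T -> R) h :
  (forall i, finite_energy c (F i)) -> finite_energy c h ->
  en (fun x => \sum_(i <- r) a i * F i x) h = \sum_(i <- r) a i * en (F i) h.
Proof.
move=> FF Fh; elim: r => [|i r IH]; last first.
  under [X in en X]eq_fun do rewrite big_cons.
  by rewrite enZD// ?IH ?big_cons//; exact: finite_energy_sum.
rewrite big_nil; under [X in en X]eq_fun do rewrite big_nil.
have F0 := (finite_energy_cst 0).1.
(* Bilinearity with both arguments zero says that E(0, h) equals its own double, hence vanishes. *)
have := enZD 1 F0 F0 Fh; rewrite /= mulr0 addr0 mul1r.
by move/eqP; rewrite -subr_eq subrr => /eqP <-.
Qed.

Lemma en_term_le f x y : finite_energy c f ->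
  c x y * (f x - f y) ^+ 2 <= 2 * en f f.
Proof.
move=> Ff; have := @finite_energy_sum_le f [:: (x, y)] Ff isT.
by rewrite big_seq1 energy_termE.
Qed.

Lemma rsum_point (S : choiceType) (q : S) (k : R) : 0 <= k ->
  summable [set: S] (EFin \o (fun p => if p == q then k else 0)) /\
  rsum (fun p => if p == q then k else 0) = k.
Proof.
move=> k0; have E : \esum_(p in [set: S]) (if p == q then k else 0)%:E = k%:E.
  transitivity (\esum_(p in [set: S]) if p \in [set q] then k%:E else 0%E).
    apply: eq_esum => p _; case: eqVneq => [->|pq]; first by rewrite mem_set.
    by rewrite memNset//= => /eqP; rewrite (negPf pq).
  by rewrite -esum_mkcond esum_set1// lee_fin.
split; last by rewrite /rsum signed_esum_ge0 ?E// => p; case: ifP.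
rewrite /summable -/(\esum_(p in [set: S]) _).
rewrite (eq_esum (b := fun p => (if p == q then k else 0)%:E)) ?E ?ltry//.
by move=> p _ /=; case: ifP => _; rewrite ger0_norm.
Qed.

(** * Energies of indicators of points *)

Section Indicators.
Hypothesis c_sym : forall x y, c x y = c y x.
Hypothesis c_diag : forall x, c x x = 0.
Hypothesis c_fin : forall x, (\esum_(y in [set: T]) (c x y)%:E < +oo)%E.

Lemma indic1E x y : \1_[set x] y = (y == x)%:R :> R.
Proof.
rewrite indicE; congr (nat_of_bool _ )%:R.
by apply/idP/eqP; rewrite inE.
Qed.

Lemma summable_cond x : summable [set: T] (EFin \o c x).
Proof.
apply: le_lt_trans (c_fin x); apply: le_esum => y _ /=.
by rewrite ger0_norm.
Qed.

Lemma esum_row x (a : T -> T -> R) :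
  \esum_(p in [set: T * T]) (if p.1 == x then a p.1 p.2 else 0)%:E =
  \esum_(y in [set: T]) (a x y)%:E.
Proof.
rewrite -(esum_image [set: T] (pair x) (fun p => (a p.1 p.2)%:E)); last first.
  by move=> y z _ _ [].
rewrite [RHS]esum_mkcond; apply: eq_esum => -[y z] _ /=.
case: eqVneq => [->|yx]; first by rewrite mem_set//; exists z.
by rewrite memNset// => -[w _ [/esym/eqP]]; rewrite (negPf yx).
Qed.

Lemma esum_col x (a : T -> T -> R) :
  \esum_(p in [set: T * T]) (if p.2 == x then a p.1 p.2 else 0)%:E =
  \esum_(y in [set: T]) (a y x)%:E.
Proof.
rewrite -(esum_image [set: T] (fun y => (y, x)) (fun p => (a p.1 p.2)%:E)); last first.
  by move=> y z _ _ [].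
rewrite [RHS]esum_mkcond; apply: eq_esum => -[y z] _ /=.
case: eqVneq => [->|zx]; first by rewrite mem_set//; exists y.
by rewrite memNset// => -[w _ [_ /esym/eqP]]; rewrite (negPf zx).
Qed.

(** Only ordered pairs with exactly one coordinate equal to [x] contribute: a row and a column,
    equal by symmetry, which cancel the factor 1/2. *)
Lemma energy_indic x : energy c \1_[set x] \1_[set x] =
  \esum_(y in [set: T]) (c x y)%:E.
Proof.
rewrite energy_diagE.
rewrite (eq_esum (b := fun p => (if p.1 == x then c p.1 p.2 else 0)%:E +
    (if p.2 == x then c p.1 p.2 else 0)%:E)%E); last first.
  move=> -[y z] _; rewrite energy_termE !indic1E /=; congr EFin.
  case: (eqVneq y x) => [->|_]; case: (eqVneq z x) => [->|_] /=;
    by rewrite ?c_diag; ring.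
rewrite esumD; [|by move=> p _; case: ifP; rewrite lee_fin..].
rewrite esum_row esum_col.
under [X in (_ + X)%E]eq_esum do rewrite c_sym.
have := fineK (esum_fin_numE (c0 x) (summable_cond x)) => <-.
by rewrite -EFinD -EFinM; congr EFin; field.
Qed.

Lemma finite_energy_indic x : finite_energy c \1_[set x].
Proof. by rewrite /finite_energy /= energy_indic. Qed.

Lemma en_indic x : en \1_[set x] \1_[set x] = rsum (c x).
Proof. by rewrite /en energy_indic rsum_ge0E//; exact: summable_cond. Qed.

Lemma en_indic_neq x y : x != y -> en \1_[set x] \1_[set y] = - c x y.
Proof.
move=> xy; rewrite en_rsum; [|exact: finite_energy_indic..].
have [s1 r1] := rsum_point (x, y) (c0 x y).
have [s2 r2] := rsum_point (y, x) (c0 x y).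
have -> : energy_term \1_[set x] \1_[set y] = fun p =>
    - ((if p == (x, y) then c x y else 0) + (if p == (y, x) then c x y else 0)).
  apply/funext => -[u v]; rewrite /energy_term !indic1E !xpair_eqE /=.
  case: (eqVneq u x) => [->|_]; case: (eqVneq v x) => [->|_] /=;
    rewrite ?(negPf xy) ?c_diag ?andbF/=.
  - by ring.
  - by case: eqVneq => [->|_] /=; rewrite ?subrr; ring.
  - by case: eqVneq => [->|_] /=; rewrite 1?c_sym; ring.
  - by ring.
rewrite rsumN; last exact: summableD s1 s2.
by rewrite rsumD// r1 r2; field.
Qed.

End Indicators.
End Energy.

(** * Compactness on a network *)

Lemma ler_addinvn (R : realType) (x y k : R) :
  (forall n : nat, x <= y + k * n.+1%:R^-1) -> x <= y.
Proof.
move=> le; rewrite leNgt; apply/negP => yx.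
have xy0 : 0 < x - y by rewrite subr_gt0.
pose n := Num.truncn (k / (x - y)).
have : k / (x - y) < n.+1%:R by rewrite truncnS_gt.
rewrite ltr_pdivrMr// => kn; have := le n; apply/negP; rewrite -ltNge.
by rewrite -ltrBrDl ltr_pdivrMr// mulrC.
Qed.

(** By Tychonoff the sequence lives in a compact product of segments and has a cluster point;
    finitely many coordinates cut out a neighbourhood of it. *)
Lemma pointwise_cluster (R : realType) (V : choiceType) (k : nat -> V -> R)
    (b : V -> R) : (forall n x, `|k n x| <= b x) ->
  exists u : V -> R, forall (s : seq V) (eps : R) (N : nat), 0 < eps ->
    exists2 n, (N <= n)%N & forall x, x \in s -> `|k n x - u x| < eps.
Proof.
move=> kb; pose P := prod_topology (fun _ : V => R).
have cpt := @tychonoff V (fun=> R) (fun x => `[- b x, b x]%classic)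
  (fun x => @segment_compact R _ _).
pose F : set_system P := (k : nat -> P) @ \oo.
have FF : ProperFilter F by exact: fmap_proper_filter.
have [|u [_ clu]] := cpt F FF.
  by exists 0 => // n _ x /=; rewrite in_itv/= -ler_norml.
exists u => s eps N eps0.
have Fk : F (k @` [set n | (N <= n)%N]).
  by exists N => // n /= Nn; exists n.
have Bu : nbhs (u : P) [set f | forall x, x \in s -> `|f x - u x| < eps].
  elim: s => [|x s IH]; first by apply: (@filterS _ (nbhs (u : P)) _ setT) => //; exact: filterT.
  have Hx : nbhs (u : P) [set f : P | `|f x - u x| < eps].
    have ux : nbhs (u x) [set y : R | `|y - u x| < eps].
      apply/nbhs_ballP; exists eps => // y; rewrite -ball_normE /=.
      by rewrite distrC.
    exact: (@proj_continuous V (fun=> R) x u _ ux).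
  apply: (@filterS _ (nbhs (u : P)) _ _ _ _ (filterI Hx IH)) => f [fx fs] y.
  by rewrite in_cons => /predU1P[->|/fs].
have [_ [[n Nn <-] /= us]] := clu _ _ Fk Bu.
by exists n.
Qed.

Section WeakLimit.
Variables (R : realType) (V : choiceType) (c : V -> V -> R).
Hypothesis c0 : forall x y, 0 <= c x y.

(** A finite partial sum of the energy depends on finitely many values, so it passes to the
    pointwise limit; the supremum over partial sums keeps the bound. *)
Lemma energy_lower_semicontinuous (u : V -> R) (M : R) :
  (forall (s : seq V) (eps : R), 0 < eps -> exists k : V -> R,
    [/\ finite_energy c k, en c k k <= M + eps &
        forall x, x \in s -> `|k x - u x| < eps]) ->
  finite_energy c u /\ en c u u <= M.
Proof.
move=> approx; apply: finite_energy_ub => // s us.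
(* With z = u(p.1) - u(p.2) and |h| < 2d, one has z^2 <= (z + h)^2 + 4d|z|; [K] collects these
   errors divided by d. *)
pose K := \sum_(p <- s) c p.1 p.2 * (4 * (`|u p.1 - u p.2| + 1)).
apply: (@ler_addinvn _ _ _ (2 + K)) => N.
have N1 : 0 < N.+1%:R^-1 :> R by rewrite invr_gt0.
have [k [Fk kM close]] := approx (map fst s ++ map snd s) _ N1.
have sk := finite_energy_sum_le c0 Fk us.
have le : \sum_(p <- s) energy_term c u u p <=
    \sum_(p <- s) energy_term c k k p + N.+1%:R^-1 * K.
  rewrite /K mulr_sumr -big_split/= big_seq [leRHS]big_seq.
  apply: ler_sum => p ps; rewrite !energy_termE [_^-1 * _]mulrCA -mulrDr.
  rewrite ler_wpM2l//.
  have [] : `|k p.1 - u p.1| < N.+1%:R^-1 /\ `|k p.2 - u p.2| < N.+1%:R^-1.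
    by split; apply: close; rewrite mem_cat; apply/orP; [left|right]; apply/mapP; exists p.
  have : N.+1%:R^-1 <= 1 :> R by rewrite invf_le1// ler1n.
  set d := N.+1%:R^-1 in N1 * => d1; rewrite !ltr_norml => /andP[a1 a2] /andP[b1 b2].
  have := ler_norm (u p.1 - u p.2); have := ler_norm (- (u p.1 - u p.2)).
  rewrite normrN; set w := `|_|; move: (u p.1) (u p.2) (k p.1) (k p.2) a1 a2 b1 b2.
  move=> x y x' y' a1 a2 b1 b2 w1 w2.
  have -> : x' - y' = x - y + ((x' - x) - (y' - y)) by ring.
  move: a1 a2 b1 b2 w1 w2; set f := x' - x; set g := y' - y; set z := x - y.
  move=> a1 a2 b1 b2 w1 w2.
  (* The two products add up to 4dw + 2(f - g)z, which bounds the cross term from below. *)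
  have : 0 <= (2 * d + (f - g)) * (w + z) by apply: mulr_ge0; lra.
  have : 0 <= (2 * d - (f - g)) * (w - z) by apply: mulr_ge0; lra.
  have := sqr_ge0 (f - g).
  lra.
move: N.+1%:R^-1 K N1 kM le {close} => d K d0 kM le.
lra.
Qed.

End WeakLimit.

(** * Pointwise control by the energy on a connected network *)

Section Network.
Variables (R : realType) (V : choiceType) (e : rel V) (c : V -> V -> R).
Hypothesis net : electrical_network e c.

Let c0 := network_cond_ge0 net.

(** Induction along a path: the first edge bounds its squared increment by 2E/c(x,z), and (a + b)^2
    <= 2a^2 + 2b^2 joins it to the rest. The constant does not depend on [u]. *)
Lemma network_diff_bound x y : exists2 K, 0 <= K &
  forall u, finite_energy c u -> (u x - u y) ^+ 2 <= K * en c u u.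
Proof.
have [p] := network_connected net x y.
elim: p x => [|z p IH] x /=.
  move=> _ ->; exists 0 => // u _.
  by rewrite subrr expr0n mul0r.
move=> /andP[exz pz] ly; have [K K0 HK] := IH _ pz ly.
have cxz : 0 < c x z by rewrite (network_cond_edge net).
exists (4 / c x z + 2 * K) => [|u Fu].
  by rewrite addr_ge0 ?mulr_ge0// invr_ge0 ltW.
have h1 : (u x - u z) ^+ 2 <= 2 / c x z * en c u u.
  by rewrite mulrAC ler_pdivlMr// mulrC en_term_le.
have := HK _ Fu; have := sqr_ge0 ((u x - u z) - (u z - u y)).
have -> : (4 / c x z + 2 * K) * en c u u =
  2 * (2 / c x z * en c u u) + 2 * (K * en c u u) by ring.
lra.
Qed.

Lemma energy0_cst u x y : finite_energy c u -> en c u u <= 0 -> u x = u y.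
Proof.
move=> Fu u0; have [K K0 /(_ u Fu) le] := network_diff_bound x y.
apply/eqP; rewrite -subr_eq0 -sqrf_eq0 eq_le sqr_ge0 andbT.
by apply: le_trans le _; rewrite mulr_ge0_le0.
Qed.

Lemma bounded_energy_extension (B : set V) (o : B) (phi : B -> R) (M : R) :
  (forall (s : seq B) (eps : R), 0 < eps -> exists k : V -> R,
    [/\ finite_energy c k, en c k k <= M + eps &
        forall x, x \in s -> `|k (val x) - phi x| <= eps]) ->
  exists u, [/\ finite_energy c u, en c u u <= M & restriction B u = phi].
Proof.
move=> approx.
have [j jinj] : exists j : V -> nat, injective j.
  have /countable_injP[j jinj] := network_countable net.
  by exists j => x y; apply: jinj; rewrite inE.
have /choice[A HA] : forall n, exists s : seq B,
    (* The lists [A n] exhaust [B], so the n-th approximant can be required to match [phi] on a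
       growing finite set. *)
    forall x : B, (j (val x) < n)%N -> x \in s.
  move=> n; have : finite_set ((fun x : B => j (val x)) @^-1` `I_n).
    apply: finite_preimage => [x y _ _ /jinj/val_inj //|].
    exact: finite_II.
  by move=> /finite_seqP[s Es]; exists s => x xn; move: Es => /seteqP[/(_ x xn)].
have /choice[k Hk] : forall n, exists k : V -> R,
    [/\ finite_energy c k, en c k k <= M + n.+1%:R^-1 &
        (* The base point [o] is in every list: it anchors the approximants, whose increments are
           controlled by the energy. *)
        forall x, x \in o :: A n -> `|k (val x) - phi x| <= n.+1%:R^-1].
  by move=> n; apply: approx; rewrite invr_gt0.
have n1 n : n.+1%:R^-1 <= 1 :> R by rewrite invf_le1// ler1n.
have /choice[K HK] : forall x, exists K, 0 <= K /\
  forall u, finite_energy c u -> (u x - u (val o)) ^+ 2 <= K * en c u u.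
  by move=> x; have [K K0 ?] := network_diff_bound x (val o); exists K.
have [|u clu] := @pointwise_cluster R V k
    (fun x => `|phi o| + 2 + K x * (M + 1)).
  move=> n x; have [Kx0 HKx] := HK x; have [Fk kM ko] := Hk n.
  have le2 : (k n x - k n (val o)) ^+ 2 <= K x * (M + 1).
    apply: le_trans (HKx _ Fk) _; rewrite ler_wpM2l// (le_trans kM)// lerD2l.
    exact: n1.
  have h1 : `|k n x - k n (val o)| <= 1 + (k n x - k n (val o)) ^+ 2.
    set d := _ - _; rewrite ler_norml; have := sqr_ge0 (d - 1).
    have := sqr_ge0 (d + 1); have := sqr_ge0 d.
    by move=> *; apply/andP; split; lra.
  have h2 := ler_normD (k n x - k n (val o)) (k n (val o)).
  have h3 := ler_normD (k n (val o) - phi o) (phi o).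
  have h4 := le_trans (ko o (mem_head _ _)) (n1 n).
  by move: h2 h3; rewrite !subrK => h2 h3; lra.
have small (eps : R) : 0 < eps -> exists N, forall n, (N <= n)%N -> n.+1%:R^-1 <= eps.
  move=> eps0; exists (Num.truncn eps^-1) => n Nn.
  rewrite -[leRHS]invrK lef_pV2 ?posrE ?invr_gt0//.
  by apply: ltW; apply: lt_le_trans (truncnS_gt _) _; rewrite ler_nat.
exists u; have [] := @energy_lower_semicontinuous R V c c0 u M.
  move=> s eps eps0; have [N HN] := small _ eps0.
  have [n Nn close] := clu s eps N eps0; have [Fk kM _] := Hk n.
  by exists (k n); split=> //; apply: le_trans kM _; rewrite lerD2l HN.
move=> Fu uM; split=> //; apply/funext => x; rewrite /restriction.
apply/eqP; rewrite -subr_eq0 -normr_le0; apply/ler_addgt0Pl => eps eps0.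
have e2 : 0 < eps / 2 by rewrite divr_gt0.
have [N HN] := small _ e2.
(* [A n] is only known to contain indices strictly below [n], hence the successor. *)
have [n] := clu [:: val x] _ (maxn N (j (val x)).+1) e2.
rewrite geq_max => /andP[Nn jn] /(_ (val x) (mem_head _ _)) h1.
have [_ _ /(_ x)] := Hk n; rewrite in_cons HA ?orbT// => /(_ isT) h2.
have h3 := le_trans h2 (HN _ Nn); rewrite addr0.
have := ler_distD (k n (val x)) (u (val x)) (phi x).
rewrite [`|u _ - k n _|]distrC; lra.
Qed.

End Network.

(** * Cutoffs and finitely supported approximation *)

Definition finitely_supported (R : realType) (T : choiceType) (f : T -> R) :=
  exists s : seq T, forall x, x \notin s -> f x = 0.

(* This is the form in which recurrence is inherited by a trace network. *)
Definition has_cutoffs (R : realType) (T : choiceType) (c : T -> T -> R) :=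
  forall (s : seq T) (eps : R), 0 < eps -> exists f : T -> R,
    [/\ finitely_supported f, forall x, 0 <= f x <= 1,
        forall x, x \in s -> 1 - eps <= f x &
        finite_energy c f /\ en c f f <= eps].

Lemma clampE (R : realType) (M x : R) : `|x| <= M ->
  Num.max (- M) (Num.min M x) = x.
Proof. by rewrite ler_norml => /andP[Mx xM]; rewrite (min_idPr xM) (max_idPr Mx). Qed.

Lemma clamp_norm (R : realType) (M x : R) : 0 <= M ->
  `|Num.max (- M) (Num.min M x)| <= M.
Proof.
by move=> M0; rewrite ler_norml le_max lexx ge_max ge_min lexx/= andbT; lra.
Qed.

Lemma clamp_contraction (R : realType) (a b x y : R) :
  `|Num.max a (Num.min b x) - Num.max a (Num.min b y)| <= `|x - y|.
Proof.
wlog xy : x y / x <= y.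
  move=> wl; have /orP[/wl//|/wl] := le_total x y.
  by rewrite distrC (distrC y x).
rewrite [leRHS]ler0_norm ?subr_le0// ler_norml.
by have [bx|bx] := lerP b x; have [by'|by'] := lerP b y;
  (try case: (lerP a b) => ?); (try case: (lerP a x) => ?);
  (try case: (lerP a y) => ?); apply/andP; split; lra.
Qed.

Lemma finitely_supported_approx (R : realType) (T : choiceType)
    (c : T -> T -> R) (u : T -> R) (s : seq T) (eps : R) :
  (forall x y, 0 <= c x y) -> has_cutoffs c -> finite_energy c u -> 0 < eps ->
  exists v, [/\ finitely_supported v, finite_energy c v,
    forall x, x \in s -> `|v x - u x| <= eps & en c v v <= en c u u + eps].
Proof.
move=> c0 cut Fu eps0; have u0 := en_ge0 c0 u.
pose M := 1 + \sum_(x <- s) `|u x|.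
have M1 : 1 <= M by rewrite lerDl sumr_ge0.
have uM x : x \in s -> `|u x| <= M.
  move=> xs; rewrite /M (big_rem x xs)/= addrCA lerDl.
  by rewrite addr_ge0// sumr_ge0.
pose w x := Num.max (- M) (Num.min M (u x)).
(* [M] exceeds |u| on [s], so the truncation [w] is exact there. [t] makes the loss in front of E(u)
   at most eps/2, and [d] makes both the cutoff energy term C d and the error M d at most eps/2. *)
pose t := eps / (2 * (en c u u + 1)).
have t0 : 0 < t by rewrite divr_gt0// mulr_gt0// ltr_wpDl.
pose C := (1 + t^-1) * M ^+ 2.
have C0 : 0 <= C by rewrite mulr_ge0 ?sqr_ge0// addr_ge0// invr_ge0 ltW.
pose d := eps / (2 * (C + M)).
have CM0 : 0 < C + M by lra.
have d0 : 0 < d by rewrite divr_gt0// mulr_gt0.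
have Cd : C * d + M * d = eps / 2.
  by rewrite -mulrDl /d; field; rewrite gt_eqF.
have [f [[A fA] f01 f1 [Ff fd]]] := cut s d d0.
have [Fv vle] : finite_energy c (fun x => w x * f x) /\
    en c (fun x => w x * f x) (fun x => w x * f x) <=
    (1 + t) * en c u u + C * en c f f.
  apply: finite_energy_dominated => //; first by rewrite addr_ge0 ?ltW.
  move=> x y; have wxy : `|w x - w y| <= `|u x - u y| := clamp_contraction _ _ _ _.
  have wy : `|w y| <= M by apply: clamp_norm; lra.
  have [fx0 fx1] := andP (f01 x).
  (* Leibniz rule: the first part is a contraction of [u] because [f] is at most 1, the second is
     [M] times an increment of [f]. *)
  have -> : w x * f x - w y * f y = f x * (w x - w y) + w y * (f x - f y) by ring.
  set a := f x * _; set b := w y * _.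
  have ha : a ^+ 2 <= (u x - u y) ^+ 2.
    rewrite -[leLHS]real_normK ?num_real// -[leRHS]real_normK ?num_real//.
    rewrite lerXn2r ?nnegrE// normrM (le_trans _ wxy)// ler_piMl//.
    by rewrite ger0_norm.
  have hb : b ^+ 2 <= M ^+ 2 * (f x - f y) ^+ 2.
    rewrite exprMn ler_wpM2r ?sqr_ge0// -[leLHS]real_normK ?num_real//.
    by rewrite lerXn2r// nnegrE; lra.
  (* [(a + b)^2 <= (1 + t) a^2 + (1 + 1/t) b^2] *)
  apply: (@le_trans _ _ ((1 + t) * a ^+ 2 + (1 + t^-1) * b ^+ 2)).
    have : 0 <= t^-1 * (t * a - b) ^+ 2 by rewrite mulr_ge0 ?sqr_ge0// invr_ge0 ltW.
    have -> : t^-1 * (t * a - b) ^+ 2 = t * a ^+ 2 - 2 * (a * b) + t^-1 * b ^+ 2.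
      by field; rewrite gt_eqF.
    by lra.
  rewrite lerD//; first by rewrite ler_wpM2l// addr_ge0 ?ltW.
  by rewrite /C -mulrA ler_wpM2l// addr_ge0// invr_ge0 ltW.
exists (fun x => w x * f x); split=> //.
- by exists A => x /fA ->; rewrite mulr0.
- move=> x xs; rewrite /w clampE ?uM// -[X in _ - X]mulr1 -mulrBr normrM.
  have /andP[_ fx1] := f01 x; rewrite (distrC (f x)) (@ger0_norm _ (1 - f x)) ?subr_ge0//.
  apply: (@le_trans _ _ (M * d)).
    by apply: ler_pM => //; [by rewrite subr_ge0|exact: uM|have := f1 x xs; lra].
  by have := mulr_ge0 C0 (ltW d0); lra.
- apply: (le_trans vle).
  have h1 : t * en c u u <= eps / 2.
    rewrite /t invfM mulrA mulrAC ler_pdivrMr; last by rewrite ltr_wpDl.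
    by rewrite ler_wpM2l ?divr_ge0 ?ltW// ltrDl.
  have h2 : C * en c f f <= C * d by rewrite ler_wpM2l.
  have := mulr_ge0 (le_trans ler01 M1) (ltW d0); lra.
Qed.

(** Large resistance from [rho] to the complement of a finite set gives a low-energy function with
    value 1 at [rho] and support in that set. Clamped to [0,1], it stays near 1 on [s] because its
    increments from [rho] are small. *)
Lemma recurrent_has_cutoffs (R : realType) (V : choiceType) (e : rel V)
    (c : V -> V -> R) :
  electrical_network e c -> recurrent c -> has_cutoffs c.
Proof.
move=> net [U [finU _ _ [rho cvgU]]] s eps eps0.
have c0 := network_cond_ge0 net.
have /choice[K HK] : forall x, exists K, 0 <= K /\
  forall u, finite_energy c u -> (u x - u rho) ^+ 2 <= K * en c u u.
  by move=> x; have [K K0 ?] := network_diff_bound net x rho; exists K.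
pose M := 1 + \sum_(x <- s) K x.
have K0 x : 0 <= K x by have [] := HK x.
have M0 : 0 < M by rewrite ltr_pwDl// sumr_ge0.
have KM x : x \in s -> K x <= M.
  move=> xs; rewrite /M (big_rem x xs)/= addrCA lerDl.
  by rewrite addr_ge0// sumr_ge0.
pose d := Num.min eps (eps ^+ 2 / M).
have d0 : 0 < d by rewrite lt_min eps0 divr_gt0// exprn_gt0.
have [n resn] : exists n, (d^-1%:E < effective_resistance c [set rho] (~` U n))%E.
  have /cvgeyPgt/(_ d^-1)[N _ HN] := cvgU.
  by exists N; apply: HN => /=.
have [f [Ff f1 f0] fd] : exists2 f, separating c [set rho] (~` U n) f &
    (energy c f f < d%:E)%E.
  move: resn; rewrite /effective_resistance.
  set I := ereal_inf _ => resn.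
  have Id : (I < d%:E)%E.
    (* Inversion at the boundary values: an infimum [0] has reciprocal [+oo] and is below [d], while
       [+oo] has reciprocal [0], contradicting [resn]. *)
    move: resn; case: I => [r||] //=; last by rewrite lte_fin invr_lt0 ltNge ltW.
      rewrite lte_fin inver; case: eqP => [-> //|r0] .
      rewrite lte_fin => rd; have [//|dr] := ltrP r d.
      by move: rd; rewrite ltf_pV2 ?posrE ?(lt_le_trans d0)// ltNge dr.
  by have [_ [f sf <-] fd] := ereal_inf_lt Id; exists f.
pose g x := Num.max 0 (Num.min 1 (f x)).
have [Fg gf] : finite_energy c g /\ en c g g <= en c f f.
  by apply: finite_energy_contraction => // x y; exact: clamp_contraction.
have gd : en c g g <= d.
  by apply: le_trans gf _; rewrite -lee_fin -energyEn// ltW.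
exists g; split.
- have /finite_seqP[A UA] := finU n; exists A => x xA.
  have nUx : (~` U n) x by rewrite UA /=; exact/negP.
  by rewrite /g f0// min_r ?ler01// maxxx.
- by move=> x; rewrite /g le_max lexx ge_max ler01 ge_min lexx.
- move=> x xs; have [_ /(_ _ Fg)] := HK x.
  have -> : g rho = 1 by rewrite /g f1//= minxx max_r.
  move=> le; rewrite leNgt; apply/negP => lt.
  have : (g x - 1) ^+ 2 <= eps ^+ 2.
    apply: (le_trans le); apply: (@le_trans _ _ (M * d)).
      by apply: ler_pM => //; [exact: en_ge0|exact: KM].
    by rewrite mulrC -ler_pdivlMr// ge_min lexx orbT.
  by apply/negP; rewrite -ltNge; nra.
- by split=> //; apply: le_trans gd _; rewrite ge_min lexx.
Qed.

(** * The trace network *)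

Lemma quadratic_ge0 (R : realFieldType) (a b : R) : 0 <= a ->
  (forall t, 0 <= t ^+ 2 * a + 2 * t * b) -> b = 0.
Proof.
move=> a0 h; have a1 : 0 < a + 1 by rewrite ltr_wpDl.
(* Dividing by [a + 1] instead of the optimal [a] includes the case [a = 0]. *)
have := h (- b / (a + 1)).
have -> : (- b / (a + 1)) ^+ 2 * a + 2 * (- b / (a + 1)) * b =
    - ((b / (a + 1)) ^+ 2 * (a + 2)) by field; rewrite gt_eqF.
rewrite oppr_ge0 pmulr_lle0; last by rewrite ltr_wpDl.
move=> b0; apply/eqP; have : b / (a + 1) == 0.
  by rewrite -sqrf_eq0 eq_le b0 sqr_ge0.
by rewrite mulf_eq0 invr_eq0 (gt_eqF a1) orbF.
Qed.

Section TraceNetwork.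
Variables (R : realType) (V : choiceType) (e : rel V) (c : V -> V -> R).
Variables (B : set V) (o : B).
Hypotheses (net : electrical_network e c) (rec : recurrent c).

Let c0 := network_cond_ge0 net.

(** Weak form of being a minimiser for given values on [B]; unlike minimality, it is visibly linear
    in [w]. *)
Definition harmonic_off (w : V -> R) := finite_energy c w /\
  forall v, finite_energy c v -> (forall x : B, v (val x) = 0) -> en c w v = 0.

Lemma network_cond_diag x : c x x = 0.
Proof.
apply/eqP; rewrite eq_le c0 andbT leNgt (network_cond_edge net).
by rewrite (network_edge_irr net).
Qed.

Lemma harmonic_offZD a w1 w2 : harmonic_off w1 -> harmonic_off w2 ->
  harmonic_off (fun x => a * w1 x + w2 x).
Proof.
move=> [F1 h1] [F2 h2]; split=> [|v Fv v0]; first exact: finite_energyZD.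
by rewrite enZD// h1// h2// mulr0 addr0.
Qed.

Lemma harmonic_off_sum (I : Type) (r : seq I) (a : I -> R) (F : I -> V -> R) :
  (forall i, harmonic_off (F i)) ->
  harmonic_off (fun x => \sum_(i <- r) a i * F i x).
Proof.
move=> hF; have FF i := (hF i).1; split; first exact: finite_energy_sum.
move=> v Fv v0; rewrite en_suml// big1// => i _.
by rewrite (hF i).2// mulr0.
Qed.

Lemma harmonic_off_eq w u v : harmonic_off w -> finite_energy c u ->
  finite_energy c v -> (forall x : B, u (val x) = v (val x)) ->
  en c w u = en c w v.
Proof.
move=> [Fw hw] Fu Fv uv.
have := hw _ (finite_energyZD c0 (-1) Fv Fu); rewrite enZDr//.
move=> h; apply/eqP; rewrite -subr_eq0 addrC -mulN1r h// => x.
by rewrite uv mulN1r addNr.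
Qed.

(** Since E(w, v) = E(w, w), expanding E(v - w) >= 0 leaves E(v) - E(w). *)
Lemma harmonic_off_min w v : harmonic_off w -> finite_energy c v ->
  (forall x : B, w (val x) = v (val x)) -> en c w w <= en c v v.
Proof.
move=> hw Fv wv; have [Fw _] := hw.
have := en_ge0 c0 (fun x => -1 * w x + v x).
by rewrite en_sqrZD// (harmonic_off_eq hw Fv Fw)//; lra.
Qed.

(* With [M] the infimum, near-minimisers are energy-bounded and agree with [phi]
   on [B], so they accumulate at a minimiser. *)
Lemma trace_domain_minimizer (phi : B -> R) : trace_domain c B phi ->
  energy_minimizer c phi (harmonic_extension c phi).
Proof.
move=> [v0 Fv0 v0phi].
pose S := [set en c v v | v in [set v | finite_energy c v /\ restriction B v = phi]].
have infS : has_inf S.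
  split; first by exists (en c v0 v0), v0.
  by exists 0 => _ [v _ <-]; exact: en_ge0.
have [u [Fu uS uphi]] : exists u,
    [/\ finite_energy c u, en c u u <= inf S & restriction B u = phi].
  apply: (bounded_energy_extension net o) => s eps eps0.
  have [_ [v [Fv vphi] <-] lt] := inf_adherent eps0 infS.
  by exists v; split=> //; rewrite ?ltW// => x _; rewrite -vphi subrr normr0 ltW.
apply: (@xgetPex _ (fun=> 0)); exists u; split=> // v Fv vphi.
rewrite !energyEn// lee_fin (le_trans uS)//.
by apply: ge_inf; [exact: infS.2|exists v].
Qed.

(** First variation: perturbing the minimiser by [t] times a function vanishing on [B] cannot lower
    the energy, so the linear term in [t] is zero. *)
Lemma harmonic_extension_off (phi : B -> R) : trace_domain c B phi ->
  harmonic_off (harmonic_extension c phi).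
Proof.
move=> /trace_domain_minimizer[]; set w := harmonic_extension c phi.
move=> Fw wphi wmin; split=> // v Fv v0.
rewrite en_sym; apply: (quadratic_ge0 (en_ge0 c0 v)) => t.
have Ftv := finite_energyZD c0 t Fv Fw.
have := wmin _ Ftv; rewrite !energyEn// lee_fin en_sqrZD// lerDr; apply.
by rewrite -wphi; apply/funext => x; rewrite /restriction v0 mulr0 add0r.
Qed.

Lemma harmonic_extensionE (phi : B -> R) x : trace_domain c B phi ->
  harmonic_extension c phi (val x) = phi x.
Proof.
by move=> /trace_domain_minimizer[_ + _] => /(congr1 (fun f => f x)).
Qed.

Lemma trace_domain_indic (x : B) : trace_domain c B \1_[set x].
Proof.
exists \1_[set val x]; last first.
  by apply/funext => y; rewrite /restriction !indic1E (inj_eq val_inj).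
apply: finite_energy_indic => //; [exact: network_cond_sym net|
  exact: network_cond_diag|exact: network_cond_fin net].
Qed.

Definition potential (x : B) : V -> R := harmonic_extension c \1_[set x].

Lemma potential_off x : harmonic_off (potential x).
Proof. exact/harmonic_extension_off/trace_domain_indic. Qed.

Lemma potentialE x y : potential x (val y) = (y == x)%:R.
Proof.
rewrite /potential harmonic_extensionE ?indic1E//; exact: trace_domain_indic.
Qed.

Let FP x : finite_energy c (potential x) := (potential_off x).1.

Lemma sum_delta (A : seq B) (phi : B -> R) (z : B) : uniq A ->
  (forall x, x \notin A -> phi x = 0) ->
  \sum_(y <- A) phi y * (z == y)%:R = phi z.
Proof.
move=> uA phi0; have [zA|zA] := boolP (z \in A).
  rewrite (bigD1_seq z)//= eqxx mulr1 big1 ?addr0// => y.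
  by rewrite eq_sym => /negPf ->; rewrite mulr0.
rewrite phi0// big_seq big1// => y yA; case: eqP => [zy|]; last by rewrite mulr0.
by move: zA; rewrite zy yA.
Qed.

(** An explicit harmonic function with prescribed finitely supported boundary values, on which
    bilinearity can be used directly. *)
Definition combination (A : seq B) (phi : B -> R) : V -> R :=
  fun v => \sum_(y <- A) phi y * potential y v.

Lemma combination_off A phi : harmonic_off (combination A phi).
Proof. exact/harmonic_off_sum/potential_off. Qed.

Lemma combinationE A phi z : uniq A ->
  (forall x, x \notin A -> phi x = 0) -> combination A phi (val z) = phi z.
Proof.
move=> uA phi0; rewrite /combination; under eq_bigr do rewrite potentialE.
exact: sum_delta.
Qed.

Let G x y := en c (potential x) (potential y).
Let C := trace_cond c B.

Lemma trace_condE x y : C x y = (x == y)%:R * G x x - G x y.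
Proof.
rewrite /C /trace_cond; case: eqVneq => [->|_]; first by rewrite mul1r subrr.
by rewrite mul0r sub0r.
Qed.

Lemma trace_cond_sym x y : C x y = C y x.
Proof.
rewrite !trace_condE /G (en_sym _ (potential x) (potential y)) eq_sym.
by case: eqVneq => [->|_] //; rewrite !mul0r.
Qed.

Lemma trace_cond_diag x : C x x = 0.
Proof. by rewrite /C /trace_cond eqxx. Qed.

(** On [B] the absolute value of g_y - g_x agrees with the harmonic function g_x + g_y. Hence E(g_x
    + g_y) <= E(g_y - g_x), so E(g_x, g_y) <= 0. *)
Lemma trace_cond_ge0 x y : 0 <= C x y.
Proof.
rewrite trace_condE; case: (eqVneq x y) => [->|xy]; first by rewrite mul1r subrr.
rewrite mul0r add0r oppr_ge0 /G.
pose v z := -1 * potential x z + potential y z.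
have Fv : finite_energy c v by apply: finite_energyZD.
have [Fa va] := finite_energy_contraction c0 Fv
  (fun z1 z2 => ler_dist_dist (v z1) (v z2)).
have hu := harmonic_offZD 1 (potential_off x) (potential_off y).
have agree (z : B) : 1 * potential x (val z) + potential y (val z) = `|v (val z)|.
  rewrite /v !potentialE; case: (eqVneq z x) => [->|_].
    by rewrite (negPf xy) mul1r mulN1r !addr0 normrN normr1.
  by rewrite mul1r mulr0 !add0r; case: (z == y); rewrite ?normr1 ?normr0.
have := le_trans (harmonic_off_min hu Fa agree) va; rewrite /v !en_sqrZD//; lra.
Qed.

Lemma finitely_supported_restriction (f : V -> R) : finitely_supported f ->
  finitely_supported (restriction B f).
Proof.
move=> [s fs]; exists (pmap insub s) => x xs; apply: fs.
apply: contra xs; rewrite mem_pmap => xs.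
apply/mapP; exists (val x) => //; by rewrite valK.
Qed.

(** A form of Cauchy-Schwarz, from E(f + d g_x) >= 0 and E(f - d g_x) >= 0. *)
Lemma en_small x f (d : R) : finite_energy c f -> 0 < d -> en c f f <= d ^+ 2 ->
  `|en c (potential x) f| <= d * (G x x + 1).
Proof.
move=> Ff d0 fd.
have := en_ge0 c0 (fun z => d * potential x z + f z).
have := en_ge0 c0 (fun z => (- d) * potential x z + f z).
rewrite !en_sqrZD// sqrrN -/(G x x); set E := en c _ f => h1 h2.
have G0 : 0 <= G x x by exact: en_ge0.
have ub : d * (2 * `|E|) <= d * (d * (G x x + 1)).
  by case: (ger0P E) => _; lra.
by move: ub; rewrite ler_pM2l//; have := normr_ge0 E; lra.
Qed.

(* The quantity below is [E(potential x, f)] for a cutoff [f] of small energy,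
   expanded over the boundary values of [f]. *)
Lemma row_cutoff x (s : seq B) (eps : R) : 0 < eps -> uniq s ->
  exists A : seq B, exists phi : B -> R,
  [/\ uniq (s ++ A), forall y, 0 <= phi y <= 1,
      forall y, y \in x :: s -> 1 - eps <= phi y &
      `|phi x * G x x - \sum_(y <- s ++ A) phi y * C x y| <= eps].
Proof.
move=> eps0 us; have G0 : 0 <= G x x by exact: en_ge0.
pose d := Num.min 1 (eps / (G x x + 1)).
have G1 : 0 < G x x + 1 by rewrite ltr_wpDl.
have d0 : 0 < d by rewrite lt_min ltr01 divr_gt0.
pose d' := Num.min eps (d ^+ 2).
have d'0 : 0 < d' by rewrite lt_min eps0 exprn_gt0.
have [f [fs f01 f1 [Ff fd]]] :=
  recurrent_has_cutoffs net rec (map val (x :: s)) d'0.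
have [A0 fA0] := finitely_supported_restriction fs.
(* The rest of the support, disjoint from [s], so that [s ++ A] is duplicate-free and covers the
   support. *)
pose A := [seq y <- undup A0 | y \notin s].
have uA : uniq (s ++ A).
  rewrite cat_uniq us filter_uniq ?undup_uniq// andbT/=.
  by apply/hasPn => y; rewrite mem_filter => /andP[].
exists A, (restriction B f); split=> //.
- by move=> y; exact: f01.
- move=> y ys; have := f1 (val y); rewrite map_f// => /(_ isT).
  by apply: le_trans; rewrite lerD2l lerN2 ge_min lexx.
have fA y : y \notin s ++ A -> restriction B f y = 0.
  rewrite mem_cat mem_filter negb_or => /andP[ys]; rewrite ys/= mem_undup.
  exact: fA0.
have -> : restriction B f x * G x x -
    \sum_(y <- s ++ A) restriction B f y * C x y = en c (potential x) f.
  rewrite (harmonic_off_eq (potential_off x) Ff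
    (combination_off (s ++ A) (restriction B f)).1); last first.
    by move=> z; rewrite combinationE.
  rewrite en_sym en_suml//.
  rewrite -[X in X * G x x](sum_delta x uA fA) mulr_suml -sumrB.
  by apply: eq_bigr => y _; rewrite trace_condE /G (en_sym _ (potential y)); ring.
apply: (le_trans (@en_small x f d Ff d0 _)).
  by rewrite (le_trans fd)// ge_min lexx orbT.
by rewrite -ler_pdivlMr// ge_min lexx orbT.
Qed.

Lemma trace_cond_row x :
  (\esum_(y in [set: B]) (C x y)%:E = (G x x)%:E)%E.
Proof.
have G0 : 0 <= G x x by exact: en_ge0.
have le s : uniq s -> \sum_(y <- s) C x y <= G x x.
  move=> us; set S := \sum_(y <- s) _.
  (* With error d, discarding the terms over [A] gives (1 - d) S <= G + d, that is S <= G + d (S +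
     1). *)
  apply: (@ler_addinvn _ _ _ (S + 1)) => n.
  have n0 : 0 < n.+1%:R^-1 :> R by rewrite invr_gt0.
  have [A [phi [_ phi01 phi1 close]]] := row_cutoff x n0 us.
  have h1 : (1 - n.+1%:R^-1) * S <= \sum_(y <- s ++ A) phi y * C x y.
    rewrite big_cat/= -[leLHS]addr0 lerD//; last first.
      apply: sumr_ge0 => y _; rewrite mulr_ge0 ?trace_cond_ge0//.
      by have /andP[] := phi01 y.
    rewrite mulr_sumr big_seq [leRHS]big_seq; apply: ler_sum => y ys.
    by rewrite ler_wpM2r ?trace_cond_ge0// phi1// in_cons ys orbT.
  have h2 : phi x * G x x <= G x x.
    by rewrite ler_piMl//; have /andP[] := phi01 x.
  move: close; rewrite ler_norml => /andP[close _].
  by move: n.+1%:R^-1 n0 close h1 => d *; lra.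
apply/le_anti/andP; split.
  by apply/esum_leP => //; exact: trace_cond_ge0.
have fin : (\esum_(y in [set: B]) (C x y)%:E <= (G x x)%:E)%E.
  by apply/esum_leP => //; exact: trace_cond_ge0.
have ge0 : (0 <= \esum_(y in [set: B]) (C x y)%:E)%E.
  by apply: esum_ge0 => y _; rewrite lee_fin trace_cond_ge0.
have [S ES] : exists S, \esum_(y in [set: B]) (C x y)%:E = S%:E.
  by move: fin ge0; case: (\esum_(y in _) _)%E => // r _ _; exists r.
(* Conversely, weights at most 1 and phi(x) >= 1 - d give (1 - d) G <= S + d; no prescribed finite
   set is needed here. *)
rewrite ES lee_fin; apply: (@ler_addinvn _ _ _ (1 + G x x)) => n.
have n0 : 0 < n.+1%:R^-1 :> R by rewrite invr_gt0.
have [A [phi [uA phi01 phi1 close]]] := row_cutoff x n0 (isT : uniq [::]).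
have h1 : \sum_(y <- A) phi y * C x y <= S.
  apply: (@le_trans _ _ (\sum_(y <- A) C x y)).
    apply: ler_sum => y _; rewrite ler_piMl ?trace_cond_ge0//.
    by have /andP[] := phi01 y.
  by apply: (esum_leP _ (trace_cond_ge0 x)).1 => //; rewrite ES.
have h2 : (1 - n.+1%:R^-1) * G x x <= phi x * G x x.
  by rewrite ler_wpM2r// phi1// mem_head.
move: close; rewrite ler_norml => /andP[_ close].
by move: n.+1%:R^-1 n0 close h1 h2 => d *; lra.
Qed.

Lemma trace_cond_fin x : (\esum_(y in [set: B]) (C x y)%:E < +oo)%E.
Proof. by rewrite trace_cond_row ltry. Qed.

Let FI : forall x, finite_energy C \1_[set x] :=
  finite_energy_indic trace_cond_ge0 trace_cond_sym trace_cond_diag trace_cond_fin.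

(** The diagonal case is the absence of killing: the energy of an indicator is its row sum, which
    equals E(g_x, g_x) by [trace_cond_row]. *)
Lemma en_trace_indic x y : en C \1_[set x] \1_[set y] = G x y.
Proof.
case: (eqVneq x y) => [<-|xy].
  rewrite (en_indic trace_cond_ge0 trace_cond_sym trace_cond_diag trace_cond_fin).
  rewrite /rsum signed_esum_ge0; last exact: trace_cond_ge0.
  by rewrite trace_cond_row.
rewrite (en_indic_neq trace_cond_ge0 trace_cond_sym trace_cond_diag trace_cond_fin)//.
by rewrite trace_condE (negPf xy) mul0r sub0r opprK.
Qed.

Lemma en_trace_finitely_supported (phi : B -> R) : finitely_supported phi ->
  exists w, [/\ harmonic_off w, restriction B w = phi, finite_energy C phi &
    en C phi phi = en c w w].
Proof.
move=> [A0 phiA0]; pose A := undup A0.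
have uA : uniq A by exact: undup_uniq.
have phiA x : x \notin A -> phi x = 0 by rewrite mem_undup; exact: phiA0.
have phiE : phi = fun x => \sum_(y <- A) phi y * \1_[set y] x.
  apply/funext => x; under eq_bigr do rewrite indic1E.
  by rewrite sum_delta.
have Fphi : finite_energy C phi.
  by rewrite phiE; apply: finite_energy_sum => //; exact: trace_cond_ge0.
exists (combination A phi); split=> //; first exact: combination_off.
  by apply/funext => x; rewrite /restriction combinationE.
rewrite {1}phiE en_suml//; last exact: trace_cond_ge0.
have [Fw _] := combination_off A phi.
rewrite {1}/combination en_suml//; apply: eq_bigr => x _; congr (_ * _).
rewrite en_sym {1}phiE en_suml//; last exact: trace_cond_ge0.
rewrite [RHS]en_sym en_suml//; apply: eq_bigr => y _.
by rewrite en_trace_indic.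
Qed.

Lemma en_trace_le_finitely_supported (f : V -> R) : finitely_supported f ->
  finite_energy c f ->
  finite_energy C (restriction B f) /\
  en C (restriction B f) (restriction B f) <= en c f f.
Proof.
move=> /finitely_supported_restriction/en_trace_finitely_supported[w [hw wf FC ->]] Ff.
split=> //; apply: harmonic_off_min => // x.
exact: (congr1 (fun h => h x) wf).
Qed.

(** Restricting a cutoff keeps its support finite and does not raise its energy. The approximation
    result thus applies on [B] before connectedness of the trace is established. *)
Lemma trace_has_cutoffs : has_cutoffs C.
Proof.
move=> s eps eps0.
have [f [fs f01 f1 [Ff fe]]] := recurrent_has_cutoffs net rec (map val s) eps0.
have [FC le] := en_trace_le_finitely_supported fs Ff.
exists (restriction B f); split.
- exact: finitely_supported_restriction.
- by move=> x; exact: f01.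
- by move=> x xs; apply: f1; rewrite map_f.
- by split=> //; exact: le_trans le fe.
Qed.

Lemma en_trace_le (f : V -> R) : finite_energy c f ->
  finite_energy C (restriction B f) /\
  en C (restriction B f) (restriction B f) <= en c f f.
Proof.
move=> Ff; apply: energy_lower_semicontinuous; first exact: trace_cond_ge0.
(* Half of [eps], because the approximation gives a non-strict bound and semicontinuity asks for a
   strict one. *)
move=> s eps eps0; have e2 : 0 < eps / 2 by rewrite divr_gt0.
have [v [vs Fv close ve]] := finitely_supported_approx (map val s) c0
  (recurrent_has_cutoffs net rec) Ff e2.
have [FC le] := en_trace_le_finitely_supported vs Fv.
exists (restriction B v); split=> //; first by lra.
by move=> x xs; apply: le_lt_trans (close (val x) _) _; [rewrite map_f|lra].
Qed.

Lemma trace_extension (phi : B -> R) : finite_energy C phi ->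
  exists u, [/\ finite_energy c u, en c u u <= en C phi phi &
                restriction B u = phi].
Proof.
move=> Fphi; apply: (bounded_energy_extension net o) => s eps eps0.
have [v [vs Fv close ve]] := finitely_supported_approx s trace_cond_ge0
  trace_has_cutoffs Fphi eps0.
have [w [[Fw _] wv _ ew]] := en_trace_finitely_supported vs.
exists w; split=> //; first by rewrite -ew.
by move=> x xs; rewrite -[w (val x)]/(restriction B w x) wv close.
Qed.

End TraceNetwork.

(** * Identification of the trace form and its resistance metric *)

Section TraceTheorem.
Variables (R : realType) (V : choiceType) (e : rel V) (c : V -> V -> R).
Variables (B : set V) (o : B).
Hypotheses (net : electrical_network e c) (rec : recurrent c).

Let C := trace_cond c B.
Let c0 := network_cond_ge0 net.
Let C0 := trace_cond_ge0 o net.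

Lemma trace_electrical_network : electrical_network (trace_edge c B) C.
Proof.
split.
- by exists o.
- have /countable_injP[j jinj] := network_countable net.
  apply/countable_injP; exists (j \o val) => x y _ _ /= jxy.
  by apply: val_inj; apply: jinj; rewrite ?inE.
- by move=> x; rewrite /trace_edge (trace_cond_diag c) ltxx.
- by move=> x y; rewrite /trace_edge (trace_cond_sym c).
- move=> x y.
  (* [D] is the component of [x]. Its indicator is constant along edges, so it has zero energy; its
     extension to [V] has zero energy too and is constant by connectedness of the original
     network. *)
  pose D z := exists2 p, path (trace_edge c B) x p & last x p = z.
  pose phi z : R := (`[< D z >])%:R.
  have step z1 z2 : trace_edge c B z1 z2 -> D z1 -> D z2.
    move=> z12 [p xp lp]; exists (rcons p z2); last by rewrite last_rcons.
    by rewrite rcons_path xp lp.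
  have [FC phi0] : finite_energy C phi /\ en C phi phi <= 0.
    apply: finite_energy_ub => // s _; rewrite mulr0 big1// => -[z1 z2] _.
    rewrite energy_termE /=; have [C12|C12] := ltrP 0 (C z1 z2); last first.
      by rewrite (_ : C z1 z2 = 0) ?mul0r//; apply/le_anti; rewrite C12 C0.
    have -> : phi z1 = phi z2.
      congr (nat_of_bool _)%:R; apply/asbool_equiv_eq; split; apply: step => //.
      by rewrite /trace_edge (trace_cond_sym c).
    by rewrite subrr expr0n mulr0.
  have [u [Fu u0 uphi]] := trace_extension o net rec FC.
  have : phi x = phi y.
    by rewrite -uphi; apply: (energy0_cst net) => //; exact: le_trans u0 phi0.
  rewrite /phi (asboolT (_ : D x)); last by exists [::].
  by case: asboolP => // _ /eqP; rewrite oner_eq0.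
- exact: C0.
- exact: (trace_cond_sym c).
- by [].
- exact: (trace_cond_fin o net rec).
Qed.

Lemma finite_energy_trace : finite_energy C = trace_domain c B.
Proof.
apply/seteqP; split=> [phi /(trace_extension o net rec)[u [Fu _ <-]]|_ [u Fu <-]].
  by exists u.
exact: (en_trace_le o net rec Fu).1.
Qed.

(** Restriction does not raise the energy. Conversely, the extension of the restriction has the same
    boundary values as [w], so minimality of [w] gives the other inequality. *)
Lemma en_harmonic_trace w : harmonic_off c B w ->
  en C (restriction B w) (restriction B w) = en c w w.
Proof.
move=> hw; have [FC le] := en_trace_le o net rec hw.1.
apply/le_anti; rewrite le/=.
have [u [Fu uC uw]] := trace_extension o net rec FC.
apply: le_trans uC; apply: (harmonic_off_min net hw) => // x.
exact: esym (congr1 (fun h => h x) uw).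
Qed.

Lemma energy_trace_form phi psi : trace_domain c B phi -> trace_domain c B psi ->
  energy C phi psi = trace_form c B phi psi.
Proof.
move=> dphi dpsi; rewrite /trace_form.
have hphi := harmonic_extension_off o net dphi.
have hpsi := harmonic_extension_off o net dpsi.
have [Fphi _] := hphi; have [Fpsi _] := hpsi.
have ephi := en_harmonic_trace hphi; have epsi := en_harmonic_trace hpsi.
(* Polarisation: the sum of the two harmonic extensions is harmonic, so the diagonal identity also
   holds for it and isolates the cross term. *)
have esum := en_harmonic_trace (harmonic_offZD net 1 hphi hpsi).
have Ephi : restriction B (harmonic_extension c phi) = phi.
  by apply/funext => x; exact: (harmonic_extensionE o net).
have Epsi : restriction B (harmonic_extension c psi) = psi.
  by apply/funext => x; exact: (harmonic_extensionE o net).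
have Esum : restriction B
    (fun x => 1 * harmonic_extension c phi x + harmonic_extension c psi x) =
    fun x => 1 * phi x + psi x.
  by rewrite -{2}Ephi -{2}Epsi.
have FCphi : finite_energy C phi by rewrite finite_energy_trace.
have FCpsi : finite_energy C psi by rewrite finite_energy_trace.
rewrite Ephi in ephi; rewrite Epsi in epsi; rewrite Esum in esum.
rewrite !en_sqrZD// in esum.
by rewrite !energyEn//; congr EFin; lra.
Qed.

Lemma resistance_ratio_bound x y : exists2 K, 0 <= K &
  forall u, finite_energy c u -> (0 < energy c u u)%E ->
    `|u x - u y| ^+ 2 / fine (energy c u u) <= K.
Proof.
have [K K0 HK] := network_diff_bound net x y; exists K => // u Fu.
rewrite energyEn//= lte_fin => u0; rewrite ler_pdivrMr//.
by rewrite real_normK ?num_real// HK.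
Qed.

Lemma resistance_metric_trace (x y : B) :
  resistance_metric C x y = resistance_metric c (val x) (val y).
Proof.
rewrite /resistance_metric; set S1 := [set _ | _ in _]; set S2 := [set _ | _ in _].
have [K K0 HK] := resistance_ratio_bound (val x) (val y).
have S2_ub : has_ubound S2 by exists K => _ [u [Fu u0] <-]; exact: HK.
have S12 : S1 `<=` S2.
  move=> _ [phi [Fphi phi0] <-].
  have dphi : trace_domain c B phi by rewrite -finite_energy_trace.
  have [Fu _] := harmonic_extension_off o net dphi.
  exists (harmonic_extension c phi).
    by split=> //; rewrite -[X in (_ < X)%E](energy_trace_form dphi dphi).
  rewrite !(harmonic_extensionE o net)//.
  by rewrite (energy_trace_form dphi dphi).
have S1_ge0 r : S1 r -> 0 <= r.
  move=> [phi [Fphi phi0] <-]; rewrite divr_ge0 ?sqr_ge0//.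
  by rewrite fine_ge0// ltW.
(* Restriction lowers the energy and so raises the ratio, unless the restricted energy vanishes;
   then [u] takes equal values at the two points and the ratio is 0. *)
have S21 r : S2 r -> r <= 0 \/ exists2 r', S1 r' & r <= r'.
  move=> [u [Fu]]; rewrite energyEn//= lte_fin => u0 <-.
  have [FC le] := en_trace_le o net rec Fu.
  have [E0|E0] := ltrP 0 (en C (restriction B u) (restriction B u)).
    right; exists (`|u (val x) - u (val y)| ^+ 2 /
        en C (restriction B u) (restriction B u)).
      exists (restriction B u); last by rewrite energyEn.
      by split=> //; rewrite energyEn.
    by rewrite ler_wpM2l ?sqr_ge0// lef_pV2.
  left; have [v [Fv v0 vu]] := trace_extension o net rec FC.
  have := energy0_cst net (val x) (val y) Fv (le_trans v0 E0).
  rewrite -[v (val x)]/(restriction B v x) -[v (val y)]/(restriction B v y) vu.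
  by rewrite /restriction => ->; rewrite subrr normr0 expr0n mul0r.
have [S10|/set0P/negP/negPn/eqP S10] := pselect (S1 !=set0).
  have S1_sup : has_sup S1.
    by split=> //; have [b Hb] := S2_ub; exists b => r /S12; exact: Hb.
  have sup0 : 0 <= sup S1.
    have [r S1r] := S10; apply: le_trans (S1_ge0 _ S1r) _.
    exact: ub_le_sup S1_sup.2 _ S1r.
  apply/le_anti/andP; split.
    by apply: ge_sup => // r /S12; exact: ub_le_sup.
  apply: ge_sup; first by have [r /S12] := S10; exists r.
  move=> r /S21[r0|[r' S1r' rr']]; first exact: le_trans r0 sup0.
  by apply: le_trans rr' _; exact: ub_le_sup S1_sup.2 _ S1r'.
(* With [S1] empty, its supremum is 0 by convention; [S2] is then empty or the singleton of 0, with
   the same supremum. *)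
rewrite S10 sup0; have S20 r : S2 r -> r = 0.
  move=> S2r; apply/le_anti; case: (S21 r S2r) => [->|[r']]; last by rewrite S10.
  by case: S2r => u [Fu u0] <-; rewrite divr_ge0 ?sqr_ge0// fine_ge0// ltW.
have [[r S2r]|/set0P/negP/negPn/eqP ->] := pselect (S2 !=set0); last by rewrite sup0.
rewrite (_ : S2 = [set 0]) ?sup1//; apply/seteqP; split=> [t /S20 //|t /= ->].
by rewrite -(S20 r S2r).
Qed.

End TraceTheorem.

Theorem theorem4p5 (R : realType) (V : choiceType) (e : rel V)
    (c : V -> V -> R) (B : set V) :
  electrical_network e c -> recurrent c -> B !=set0 ->
  [/\ electrical_network (trace_edge c B) (trace_cond c B),
      finite_energy (trace_cond c B) = trace_domain c B,
      (forall phi psi : B -> R,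
         trace_domain c B phi -> trace_domain c B psi ->
         energy (trace_cond c B) phi psi = trace_form c B phi psi) &
      (forall x y : B,
         resistance_metric (trace_cond c B) x y =
         resistance_metric c (val x) (val y))].
Proof.
move=> net rec [x Bx]; pose o : B := SigSub (mem_set Bx).
split.
- exact: trace_electrical_network o net rec.
- exact: finite_energy_trace o net rec.
- exact: energy_trace_form o net rec.
- exact: resistance_metric_trace o net rec.
Qed.
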